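(* Let $G = (\{1,\ldots,k\},\{e_1,\ldots,e_l\})$ be a non-empty finite weighted hypergraph (each hyperedge $e_j$ a nonempty subset of $\{1,\ldots,k\}$) with vertex weights $w_1,\ldots,w_k>0$ and hyperedge costs $c_1,\ldots,c_l>0$, let $d\ge 3$, and let $\alpha,\beta,\gamma,\delta>0$ be constants. Let $$U := \{(x_1,\ldots,x_k)\in\mathbf{R}^{d\times k} \mid x_i\neq x_j \text{ for all } 1\le i<j\le k\},$$ and define $f:U\to[0,\infty)$ by $$f(x_1,\ldots,x_k) := \frac{\alpha}{2}\sum_{j=1}^l c_j\sum_{i\in e_j}\|x_i - z_j\|^{\gamma} + \frac{\beta}{2}\sum_{j=1}^k\sum_{\substack{i=1\\ i\neq j}}^k \frac{w_i\,w_j}{\|x_i-x_j\|^{\delta}},\qquad z_j := \frac{1}{|e_j|}\sum_{i\in e_j} x_i .$$ Then precisely one of the following statements is true: (1) there exists $(x_1,\ldots,x_k)\in U$ at which $f$ attains its minimum over $U$; (2) $G$ is disconnected, i.e. the vertex set can be written as a disjoint union $V = V_1\cup V_2$ with $V_1,V_2\neq\emptyset$ such that every hyperedge $e_j$ satisfies $e_j\subseteq V_1$ or $e_j\subseteq V_2$.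
   Context: A hypergraph is a pair $(V,E)$ where $V$ is a set of vertices and $E$ a collection of subsets of $V$ (hyperedges). $\|\cdot\|$ denotes the Euclidean norm on $\mathbf{R}^d$. *)

(* Defs.v *)
From HB Require Import structures.
From mathcomp Require Import all_boot all_order all_algebra.

Set Implicit Arguments.
Unset Strict Implicit.
Unset Printing Implicit Defensive.

(* Stated before the classical sets are loaded: they reuse the notations for
   finite sets. *)
Definition disconnected (k l : nat) (e : 'I_l -> {set 'I_k}) : Prop :=
  exists V1 V2 : {set 'I_k},
    [/\ V1 :|: V2 = [set: 'I_k], [disjoint V1 & V2],
        V1 != set0, V2 != set0
      & forall j : 'I_l, e j \subset V1 \/ e j \subset V2].

From mathcomp Require Import all_classical all_reals all_analysis.

Import Order.TTheory GRing.Theory Num.Theory.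
Local Open Scope classical_set_scope.
Local Open Scope ring_scope.

(* The norm `|v| that MathComp-Analysis puts on matrices is the sup norm, so
   the Euclidean norm is defined separately. *)
Definition enorm (R : realType) (d : nat) (v : 'cV[R]_d) : R :=
  Num.sqrt (\sum_(a < d) v a ord0 ^+ 2).

(* A point (x_1, ..., x_k) of R^(d x k) is the matrix whose columns are the
   x_i. *)
Definition config_space (R : realType) (d k : nat) : set 'M[R]_(d, k) :=
  [set x | forall i j : 'I_k, (i < j)%N -> col i x <> col j x].

Definition centroid (R : realType) (d k : nat) (A : {set 'I_k})
    (x : 'M[R]_(d, k)) : 'cV[R]_d :=
  #|A|%:R^-1 *: \sum_(i in A) col i x.

(* Only the values on [config_space] are meaningful: elsewhere the second sum
   contains divisions by zero, which MathComp evaluates to 0. *)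
Definition energy (R : realType) (d k l : nat) (e : 'I_l -> {set 'I_k})
    (w : 'I_k -> R) (c : 'I_l -> R) (alpha beta gamma delta : R)
    (x : 'M[R]_(d, k)) : R :=
  alpha / 2 * (\sum_(j < l) c j *
     \sum_(i in e j) enorm (col i x - centroid (e j) x) `^ gamma)
  + beta / 2 * (\sum_(j < k) \sum_(i < k | i != j)
     w i * w j / enorm (col i x - col j x) `^ delta).

Definition attains_min (T : Type) (R : realType) (D : set T) (f : T -> R) :
    Prop :=
  exists2 x : T, D x & forall y : T, D y -> f x <= f y.

Definition exactly_one (P Q : Prop) : Prop := (P /\ ~ Q) \/ (~ P /\ Q).

Lemma energy_ge0 (R : realType) (d k l : nat) (e : 'I_l -> {set 'I_k})
    (w : 'I_k -> R) (c : 'I_l -> R) (alpha beta gamma delta : R)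
    (x : 'M[R]_(d, k)) :
  (forall i, 0 < w i) -> (forall j, 0 < c j) -> 0 < alpha -> 0 < beta ->
  0 <= energy e w c alpha beta gamma delta x.
Proof.
move=> w0 c0 a0 b0.
have hh (a : R) : 0 < a -> 0 <= a / 2 by move=> a_gt0; rewrite divr_ge0// ltW.
apply: addr_ge0; apply: mulr_ge0; rewrite ?hh//; apply: sumr_ge0 => j _.
  apply: mulr_ge0; first exact: ltW.
  by apply: sumr_ge0 => i _; exact: powR_ge0.
apply: sumr_ge0 => i _; apply: divr_ge0; last exact: powR_ge0.
by apply: mulr_ge0; exact: ltW.
Qed.

(* Main.v *)
(* If V = V1 + V2 splits all hyperedges, translating the vertices of V1 far away
   leaves the spring terms unchanged and strictly lowers the repulsion, so there
   is no minimum. If G is connected, a bound on the energy bounds the distance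
   of each vertex to the centroids of its hyperedges, hence, along paths, all
   pairwise distances; it also bounds these away from 0. As the energy is
   translation invariant, the infimum can be taken over a compact part of U, on
   which the energy is continuous. *)
Require Import Defs.
From HB Require Import structures.
From mathcomp Require Import all_boot all_order all_algebra.

Set Implicit Arguments.
Unset Strict Implicit.
Unset Printing Implicit Defensive.

(* Stated before the classical sets are loaded: they reuse the notations for
   finite sets. *)
Definition share_edge (k l : nat) (e : 'I_l -> {set 'I_k}) : rel 'I_k :=
  fun i i' => [exists j, (i \in e j) && (i' \in e j)].

(** Otherwise the component of [i0] and its complement split the vertices: two vertices of one
    hyperedge are adjacent, so a hyperedge meeting the component lies inside it. *)
Lemma connect_share_edge (k l : nat) (e : 'I_l -> {set 'I_k}) (i0 i : 'I_k) :
  ~ disconnected e -> connect (share_edge e) i0 i.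
Proof.
move=> conn_e; apply/negPn/negP => i0_i; apply: conn_e.
exists [set i' | connect (share_edge e) i0 i'],
       (~: [set i' | connect (share_edge e) i0 i']).
split; [by rewrite setUCr| |by apply/set0Pn; exists i0; rewrite inE| |].
- by rewrite -setI_eq0 setICr.
- by apply/set0Pn; exists i; rewrite !inE.
move=> j; case: (set_0Vmem (e j :&: [set i' | connect (share_edge e) i0 i'])).
  by move=> /eqP; rewrite setI_eq0 disjoints_subset => ej; right.
move=> [i1 /setIP[i1j]]; rewrite inE => i0_i1; left; apply/subsetP => i2 i2j.
rewrite inE (connect_trans i0_i1)// connect1//.
by apply/existsP; exists j; rewrite i1j.
Qed.

From mathcomp Require Import all_classical all_reals all_analysis.
From mathcomp Require Import lra.

Import Order.TTheory GRing.Theory Num.Theory.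
Import numFieldNormedType.Exports.
Local Open Scope ring_scope.

(** * Euclidean norm and inversion of powers *)

Lemma enorm_ge0 (R : realType) (d : nat) (v : 'cV[R]_d) : 0 <= enorm v.
Proof. exact: sqrtr_ge0. Qed.

Lemma ler_norm_enorm (R : realType) (d : nat) (v : 'cV[R]_d) (a : 'I_d) :
  `|v a ord0| <= enorm v.
Proof.
rewrite -sqrtr_sqr ler_wsqrtr// (bigD1 a)//= lerDl.
by apply: sumr_ge0 => b _; exact: sqr_ge0.
Qed.

Lemma enorm_gt0 (R : realType) (d : nat) (v : 'cV[R]_d) :
  v <> 0 -> 0 < enorm v.
Proof.
move=> v0; rewrite lt_neqAle enorm_ge0 andbT eq_sym.
apply/eqP => ev; apply: v0; apply/colP => a; rewrite mxE; apply/eqP.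
by rewrite -normr_le0 -ev ler_norm_enorm.
Qed.

Lemma enormN (R : realType) (d : nat) (v : 'cV[R]_d) : enorm (- v) = enorm v.
Proof.
by congr Num.sqrt; apply: eq_bigr => a _; rewrite mxE sqrrN.
Qed.

Lemma enorm_dist_gt0 (R : realType) (d k : nat) (x : 'M[R]_(d, k))
    (i j : 'I_k) :
  config_space x -> i != j -> 0 < enorm (col i x - col j x).
Proof.
move=> Ux; wlog lt_ij : i j / (i < j)%N => [wlog_ij|] i_neq_j.
  case: (ltngtP i j) => [ij|ji|/val_inj/eqP]; first exact: wlog_ij.
    by rewrite -enormN opprB wlog_ij// eq_sym.
  by rewrite (negbTE i_neq_j).
by apply: enorm_gt0 => /subr0_eq; exact: Ux.
Qed.

Lemma config_space_of_dist_gt0 (R : realType) (d k : nat) (x : 'M[R]_(d, k)) :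
  (forall i j : 'I_k, i != j -> 0 < enorm (col i x - col j x)) ->
  config_space x.
Proof.
move=> x_sep i j ij; apply/eqP; apply: contraTN (x_sep i j _).
  move=> /eqP ->; rewrite subrr /enorm big1 ?sqrtr0 ?ltxx// => a _.
  by rewrite mxE expr0n.
by rewrite neq_ltn ij.
Qed.

Lemma ler_powR_inv (R : realType) (p a M : R) :
  0 < p -> 0 <= a -> a `^ p <= M -> a <= M `^ p^-1.
Proof.
move=> p0 a0 aM; have M0 : 0 <= M by exact: le_trans (powR_ge0 _ _) aM.
rewrite -[a]powRr1// -(divff (lt0r_neq0 p0)) powRrM.
by apply: ge0_ler_powR => //; rewrite ?nnegrE ?powR_ge0// invr_ge0 ltW.
Qed.

Lemma powR_inv_ler (R : realType) (p a m : R) :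
  0 < p -> 0 <= a -> 0 <= m -> m <= a `^ p -> m `^ p^-1 <= a.
Proof.
move=> p0 a0 m0 ma.
rewrite -[leRHS]powRr1// -(divff (lt0r_neq0 p0)) powRrM.
by apply: ge0_ler_powR => //; rewrite ?nnegrE ?powR_ge0// invr_ge0 ltW.
Qed.

(** * Continuity of the energy *)

Section Limits.
Local Open Scope classical_set_scope.

Lemma cvg_powR (R : realType) (T : Type) (F : set_system T) {FF : Filter F}
    (p : R) (f : T -> R) (r : R) :
  0 < p -> (forall t, 0 <= f t) -> 0 <= r ->
  f t @[t --> F] --> r -> f t `^ p @[t --> F] --> r `^ p.
Proof.
move=> p0 f0; rewrite le_eqVlt => /predU1P[<-|r0] fr.
  (* At the limit 0, [powR_cvg0] only covers positive arguments; where [f t] vanishes, so does its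
     power, and 0 belongs to every neighbourhood [A] of 0. *)
  rewrite powR0 ?gt_eqF// => A A0.
  have := fr _ (powR_cvg0 p0 A0); rewrite /nbhs/=.
  apply: filterS => t /=; have := f0 t.
  rewrite le_eqVlt => /predU1P[<- _|ft0]; last by apply.
  by rewrite powR0 ?gt_eqF//; exact: nbhs_singleton.
have dr := @is_derive1_powR R p r r0.
apply: (continuous_cvg _ (h := (@powR R)^~ p) _ fr).
by apply: differentiable_continuous; apply/derivable1_diffP; exact: ex_derive.
Qed.

Lemma cvg_enorm (R : realType) (T : Type) (F : set_system T) {FF : Filter F}
    (d : nat) (v : T -> 'cV[R]_d) (u : 'cV[R]_d) :
  (forall a, v t a ord0 @[t --> F] --> u a ord0) ->
  enorm (v t) @[t --> F] --> enorm u.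
Proof.
move=> vu; apply: (continuous_cvg _ (h := @Num.sqrt R));
  first exact: sqrt_continuous.
apply: cvg_big => [|a _]; first exact: add_continuous.
by apply: cvgM; exact: vu.
Qed.

(** Being in [config_space] keeps the limit denominators nonzero. The springs need continuity of the
    power at 0 too, since a vertex may coincide with its centroid. *)
Lemma cvg_energy (R : realType) (T : Type) (F : set_system T) {FF : Filter F}
    (d k l : nat) (e : 'I_l -> {set 'I_k}) (w : 'I_k -> R) (c : 'I_l -> R)
    (alpha beta gamma delta : R) (X : T -> 'M[R]_(d, k)) (x : 'M[R]_(d, k)) :
  0 < gamma -> 0 < delta -> config_space x ->
  (forall a i, X t a i @[t --> F] --> x a i) ->
  energy e w c alpha beta gamma delta (X t) @[t --> F] -->
  energy e w c alpha beta gamma delta x.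
Proof.
move=> gamma0 delta0 Ux Xx.
apply: cvgD; (apply: cvgM; first exact: cvg_cst);
    (apply: cvg_big => [|j _]; first exact: add_continuous).
  apply: cvgM; first exact: cvg_cst.
  apply: cvg_big => [|i ij]; first exact: add_continuous.
  apply: cvg_powR => // [t| |]; [exact: enorm_ge0..|].
  apply: cvg_enorm => a; under eq_fun do rewrite !mxE summxE.
  rewrite !mxE summxE; apply: cvgB; first exact: Xx.
  apply: cvgM; first exact: cvg_cst.
  apply: cvg_big => [|i' _]; first exact: add_continuous.
  by under eq_fun do rewrite mxE; rewrite mxE; exact: Xx.
apply: cvg_big => [|i ij]; first exact: add_continuous.
apply: cvgM; first exact: cvg_cst.
apply: cvgV; first by rewrite gt_eqF// powR_gt0// enorm_dist_gt0.
apply: cvg_powR => // [t| |]; [exact: enorm_ge0..|].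
apply: cvg_enorm => a; under eq_fun do rewrite !mxE.
by rewrite !mxE; apply: cvgB; exact: Xx.
Qed.

End Limits.

(** * Monotonicity of the repulsion, shifts and lower bounds *)

Lemma ltr_sum_offdiag (R : numDomainType) (I : finType) (F G : I -> I -> R)
    (i1 i2 : I) :
  i1 != i2 -> (forall i j, i != j -> F i j <= G i j) -> F i1 i2 < G i1 i2 ->
  \sum_j \sum_(i | i != j) F i j < \sum_j \sum_(i | i != j) G i j.
Proof.
move=> i12 FG FG12; rewrite (bigD1 i2)//= [ltRHS](bigD1 i2)//=.
apply: ltr_leD; last by apply: ler_sum => j _; apply: ler_sum => i; exact: FG.
rewrite (bigD1 i1)//= [ltRHS](bigD1 i1)//=; apply: ltr_leD => //.
by apply: ler_sum => i /andP[+ _]; exact: FG.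
Qed.

Lemma ler_div_powR (R : realType) (W p a b : R) :
  0 < W -> 0 <= p -> 0 < a -> a <= b -> W / b `^ p <= W / a `^ p.
Proof.
move=> W0 p0 a0 ab; have b0 := lt_le_trans a0 ab.
rewrite ler_pM2l// lef_pV2 ?posrE ?powR_gt0//.
by apply: ge0_ler_powR => //; rewrite nnegrE ltW.
Qed.

Lemma ltr_div_powR (R : realType) (W p a b : R) :
  0 < W -> 0 < p -> 0 < a -> a < b -> W / b `^ p < W / a `^ p.
Proof.
move=> W0 p0 a0 ab; have b0 := lt_trans a0 ab.
rewrite ltr_pM2l// ltf_pV2 ?posrE ?powR_gt0//.
by apply: gt0_ltr_powR => //; rewrite nnegrE ltW.
Qed.

Lemma centroid_shift (R : realType) (d k : nat) (A : {set 'I_k})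
    (x y : 'M[R]_(d, k)) (u : 'cV[R]_d) :
  A != finset.set0 -> {in A, forall i, col i y = col i x + u} ->
  centroid A y = centroid A x + u.
Proof.
move=> A0 yx; rewrite /centroid (eq_bigr _ yx) big_split/= sumr_const scalerDr.
rewrite -[u *+ _]scaler_nat scalerA mulVf ?scale1r//.
by rewrite pnatr_eq0 finset.cards_eq0.
Qed.

(** The centroid moves by the same vector as the vertices, so the two shifts cancel. The vertex [i]
    itself witnesses that [A] is nonempty. *)
Lemma spring_shift (R : realType) (d k : nat) (A : {set 'I_k})
    (x y : 'M[R]_(d, k)) (u : 'cV[R]_d) :
  {in A, forall i, col i y = col i x + u} ->
  {in A, forall i, col i y - centroid A y = col i x - centroid A x}.
Proof.
move=> yx i iA; have A0 : A != finset.set0 by apply/finset.set0Pn; exists i.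
by rewrite (centroid_shift A0 yx) (yx _ iA) opprD addrACA subrr addr0.
Qed.

Section Energy.
Context (R : realType) (d k l : nat) (e : 'I_l -> {set 'I_k}).
Context (w : 'I_k -> R) (c : 'I_l -> R) (alpha beta gamma delta : R).
Hypotheses (w_gt0 : forall i, 0 < w i) (c_gt0 : forall j, 0 < c j).
Hypotheses (alpha_gt0 : 0 < alpha) (beta_gt0 : 0 < beta).
Hypotheses (gamma_gt0 : 0 < gamma) (delta_gt0 : 0 < delta).

Local Notation U := (@config_space R d k).
Local Notation f := (@energy R d k l e w c alpha beta gamma delta).

(** Only differences of positions enter the energy. This permits moving a chosen vertex to the
    origin, which turns bounds on mutual distances into bounds on coordinates. *)
Lemma energy_translate (x y : 'M[R]_(d, k)) (u : 'cV[R]_d) :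
  (forall i, col i y = col i x + u) -> f y = f x.
Proof.
(* [congr] and [rewrite] would compare the sums for [x] and [y] by conversion,
   which does not terminate in practice. *)
move=> yx; apply: (f_equal2 (fun a b => alpha / 2 * a + beta / 2 * b)).
  apply: eq_bigr => j _; apply: (f_equal (fun a => c j * a)).
  apply: eq_bigr => i ij; apply: (f_equal (fun v => enorm v `^ gamma)).
  exact: spring_shift (in1W yx) i ij.
apply: eq_bigr => j _; apply: eq_bigr => i ij.
apply: (f_equal (fun v => w i * w j / enorm v `^ delta)).
by rewrite !yx opprD addrACA subrr addr0.
Qed.

Lemma energy_spread_lt (x y : 'M[R]_(d, k)) (i1 i2 : 'I_k) : U x ->
  (forall j i, i \in e j ->
     col i y - centroid (e j) y = col i x - centroid (e j) x) ->
  (forall i j, i != j ->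
     enorm (col i x - col j x) <= enorm (col i y - col j y)) ->
  i1 != i2 -> enorm (col i1 x - col i2 x) < enorm (col i1 y - col i2 y) ->
  f y < f x.
Proof.
move=> Ux spring_eq dist_le i12 dist_lt.
have term_le i j : i != j -> w i * w j / enorm (col i y - col j y) `^ delta
    <= w i * w j / enorm (col i x - col j x) `^ delta.
  move=> ij; apply: ler_div_powR; [exact: mulr_gt0|exact: ltW| |exact: dist_le].
  exact: enorm_dist_gt0.
apply: ler_ltD.
  rewrite le_eqVlt; apply/orP; left; apply/eqP.
  apply: (f_equal (fun a => alpha / 2 * a)).
  apply: eq_bigr => j _; apply: (f_equal (fun a => c j * a)).
  apply: eq_bigr => i ij; apply: (f_equal (fun v => enorm v `^ gamma)).
  exact: spring_eq.
rewrite ltr_pM2l; last by rewrite divr_gt0.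
apply: (ltr_sum_offdiag i12 term_le).
apply: ltr_div_powR; [exact: mulr_gt0|exact: delta_gt0| |exact: dist_lt].
exact: enorm_dist_gt0.
Qed.

(** All terms of the energy are nonnegative, so each single one is a lower bound; an energy bound
    thus controls every spring length. *)
Lemma energy_ge_spring (x : 'M[R]_(d, k)) (j : 'I_l) (i : 'I_k) :
  i \in e j ->
  alpha / 2 * c j * enorm (col i x - centroid (e j) x) `^ gamma <= f x.
Proof.
move=> ij; rewrite -mulrA -[leLHS]addr0 lerD//.
  rewrite ler_pM2l ?divr_gt0// (bigD1 j)//= -[leLHS]addr0 lerD//; last first.
    apply: sumr_ge0 => j' _; apply: mulr_ge0; first exact: ltW.
    by apply: sumr_ge0 => i' _; exact: powR_ge0.
  rewrite ler_pM2l// (bigD1 i)//= lerDl sumr_ge0// => i' _; exact: powR_ge0.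
apply: mulr_ge0; first by rewrite divr_ge0// ltW.
apply: sumr_ge0 => j' _; apply: sumr_ge0 => i' _.
by rewrite divr_ge0 ?powR_ge0// mulr_ge0// ltW.
Qed.

Lemma energy_ge_repulsion (x : 'M[R]_(d, k)) (i j : 'I_k) :
  i != j ->
  beta / 2 * (w i * w j / enorm (col i x - col j x) `^ delta) <= f x.
Proof.
have rep_ge0 i' j' : 0 <= w i' * w j' / enorm (col i' x - col j' x) `^ delta.
  by rewrite divr_ge0 ?powR_ge0// mulr_ge0// ltW.
move=> ij; rewrite -[leLHS]add0r lerD//.
  apply: mulr_ge0; first by rewrite divr_ge0// ltW.
  apply: sumr_ge0 => j' _; apply: mulr_ge0; first exact: ltW.
  by apply: sumr_ge0 => i' _; exact: powR_ge0.
rewrite ler_pM2l ?divr_gt0// (bigD1 j)//= -[leLHS]addr0 lerD//; last first.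
  by apply: sumr_ge0 => j' _; exact: sumr_ge0.
by rewrite (bigD1 i)//= lerDl sumr_ge0.
Qed.

End Energy.

(** * Disconnected hypergraphs: no minimum *)

(** Only the first coordinate [r] of [v] changes, and [(r + s)^2 - r^2 = s * (2 * r + s)] is
    positive once [|s|] exceeds [2 * |r|], whatever the signs. *)
Lemma enorm_far_shift (R : realType) (d : nat) (v : 'cV[R]_d.+1) (s : R) :
  2 * `|v ord0 ord0| < `|s| -> enorm v < enorm (v + s *: delta_mx ord0 ord0).
Proof.
move=> vs.
have lt0 : v ord0 ord0 ^+ 2 < (v ord0 ord0 + s) ^+ 2.
  have := ler_norm (- (v ord0 ord0 * s)); rewrite normrN normrM => vs_le.
  have s_gt0 : 0 < `|s| by apply: le_lt_trans vs; rewrite mulr_ge0.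
  move: (vs); rewrite -subr_gt0 => /(mulr_gt0 s_gt0).
  by have := real_normK (num_real s); nra.
have lt1 : \sum_(a < d.+1) v a ord0 ^+ 2 <
    \sum_(a < d.+1) (v + s *: delta_mx ord0 ord0) a ord0 ^+ 2.
  rewrite big_ord_recl [ltRHS]big_ord_recl !mxE eqxx mulr1 ltr_leD//.
  by apply: ler_sum => a _; rewrite !mxE /= mulr0 addr0.
rewrite /enorm ltr_sqrt//; apply: le_lt_trans lt1.
by apply: sumr_ge0 => a _; exact: sqr_ge0.
Qed.

Lemma disconnected_not_min (R : realType) (k l d : nat)
    (e : 'I_l -> {set 'I_k}) (w : 'I_k -> R) (c : 'I_l -> R)
    (alpha beta gamma delta : R) :
  (0 < d)%N -> (forall i, 0 < w i) -> 0 < beta -> 0 < delta ->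
  disconnected e ->
  ~ attains_min (@config_space R d k) (energy e w c alpha beta gamma delta).
Proof.
case: d => // d _ w0 beta0 delta0 [V1 [V2 [V12 dis12 /finset.set0Pn[i1 i1V]
  /finset.set0Pn[i2 i2V] eV]]] [x Ux x_min].
(* The sum over all pairs stands in for a maximum, and the summand 1 makes the bound strict. *)
pose t := 1 + \sum_i \sum_j 2 * `|x ord0 i - x ord0 j|.
have t_gt i j : 2 * `|x ord0 i - x ord0 j| < t.
  have dist_ge0 i' j' : 0 <= 2 * `|x ord0 i' - x ord0 j'| by rewrite mulr_ge0.
  rewrite /t (bigD1 i)//= (bigD1 j)//=.
  have := sumr_ge0 (index_enum 'I_k) (fun j' (_ : j' != j) => dist_ge0 i j').
  have : 0 <= \sum_(i' | i' != i) \sum_j' 2 * `|x ord0 i' - x ord0 j'|.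
    by apply: sumr_ge0 => i' _; exact: sumr_ge0.
  lra.
pose s (i : 'I_k) : R := if i \in V1 then t else 0.
pose y : 'M[R]_(d.+1, k) :=
  \matrix_(a, i) (x a i + s i *: delta_mx ord0 ord0 a (@ord0 0)).
have yE i : col i y = col i x + s i *: delta_mx ord0 ord0.
  by apply/colP => a; rewrite !mxE.
have dyE i j : col i y - col j y
    = (col i x - col j x) + (s i - s j) *: delta_mx ord0 ord0.
  by rewrite !yE opprD addrACA scalerBl.
(* Pairs on the same side of the split keep their difference; for the others it moves by [t] or
   [- t], far enough for [enorm_far_shift]. *)
have sP i j : s i = s j \/ 2 * `|(col i x - col j x) ord0 ord0| < `|s i - s j|.
  have t0 : 0 <= t by exact: le_trans (ltW (t_gt i1 i1)).
  rewrite /s !mxE; case: ifPn => _; case: ifPn => _;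
    [by left|right|right|by left].
    by rewrite subr0 (ger0_norm t0).
  by rewrite sub0r normrN (ger0_norm t0).
have dist_le i j : enorm (col i x - col j x) <= enorm (col i y - col j y).
  rewrite dyE; case: (sP i j) => [->|far]; first by rewrite subrr scale0r addr0.
  by apply/ltW; exact: enorm_far_shift.
have i2V1 : i2 \notin V1 by rewrite (disjointFl dis12 i2V).
have i12 : i1 != i2 by apply: contraNneq i2V1 => <-.
have dist_lt : enorm (col i1 x - col i2 x) < enorm (col i1 y - col i2 y).
  rewrite dyE; case: (sP i1 i2) => [|far]; last exact: enorm_far_shift.
  (* Equal shifts on opposite sides would force [t = 0], against [t_gt]. *)
  rewrite /s i1V (negbTE i2V1) => t0; have := t_gt i1 i2.
  by rewrite t0 ltNge mulr_ge0.
have Uy : config_space y.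
  apply: config_space_of_dist_gt0 => i j ij.
  exact: lt_le_trans (enorm_dist_gt0 Ux ij) (dist_le i j).
have := x_min y Uy; apply/negP; rewrite -ltNge.
apply: (energy_spread_lt _ _ _ w0 beta0 delta0 Ux _ _ i12 dist_lt) => // j i ij.
(* A hyperedge moves rigidly: by [t] along the first axis inside [V1], by 0 inside [V2]. *)
case: (eV j) => [/fintype.subsetP|/fintype.subsetP] ejV.
  apply: (@spring_shift _ _ _ _ _ _ (t *: delta_mx ord0 ord0)) ij.
  move=> i' /ejV i'V.
  by rewrite yE /s i'V.
apply: (@spring_shift _ _ _ _ _ _ 0) ij => i' /ejV i'V.
by rewrite yE /s (disjointFl dis12 i'V) scale0r.
Qed.

(** * Connected hypergraphs: compactness and existence of a minimum *)

(** Triangle inequality along a path. Once shortened to have no repeated vertex, the path has fewer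
    than [k] steps, so the bound is uniform in the endpoints. *)
Lemma connect_dist_le (R : realType) (k : nat) (adj : rel 'I_k)
    (g : 'I_k -> R) (B : R) :
  0 <= B -> (forall i j, adj i j -> `|g i - g j| <= B) ->
  forall i j, connect adj i j -> `|g i - g j| <= B *+ k.
Proof.
move=> B0 adjB i j /connectP[p0 + ->] => /shortenP[p ip up _].
apply: (@le_trans _ _ (B *+ size p)).
  elim: p i ip {up} => [|j1 p IHp] i /=; first by rewrite subrr normr0.
  move=> /andP[/adjB ij1 /IHp j1p]; rewrite mulrS.
  by rewrite -(subrKA (g j1)) (le_trans (ler_normD _ _))// lerD.
apply: ler_wpMn2l => //; apply: leq_trans (leqnSn _) _.
rewrite -[(size p).+1]/(size (i :: p)) -(card_uniqP up).
by rewrite -[leqRHS]card_ord max_card.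
Qed.

(* The configurations are flattened by [vec_mx] because the available product
   theorem for compact sets, [rV_compact], is about row vectors. *)
Lemma compact_config (R : realType) (d k : nat) (M : R)
    (m : 'I_k -> 'I_k -> R) :
  compact [set v : 'rV[R]_(d * k) | (forall i, - M <= v ord0 i <= M) /\
    (forall i j, i != j ->
       m i j <= enorm (col i (vec_mx v) - col j (vec_mx v)))]%classic.
Proof.
have box_compact := @rV_compact R _ (fun=> `[- M, M]%classic)
  (fun i : 'I_(d * k) => @segment_compact R (- M) M).
apply: (subclosed_compact _ box_compact); last first.
  by move=> v [vM _] i; rewrite /= in_itv/=; exact: vM.
have coord i : continuous (fun v : 'rV[R]_(d * k) => v ord0 i).
  by move=> v; exact: coord_continuous.
(* Both conditions are intersections of preimages of closed sets under continuous maps; the large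
   inequality [m i j <=] matters here. *)
apply: closedI.
  rewrite [X in closed X](_ : _ = (\bigcap_i
      ((fun v : 'rV[R]_(d * k) => v ord0 i) @^-1` `[- M, M]))%classic);
    last first.
    apply/seteqP; split=> [v vM i _|v vM i].
      by rewrite /= in_itv/=; exact: vM.
    by have := vM i Logic.I; rewrite /= in_itv.
  apply: closed_bigI => i _; apply: preimage_closed.
    by move=> v _; exact: coord.
  exact: interval_closed.
rewrite [X in closed X](_ : _ = (\bigcap_(ij in [set ij | ij.1 != ij.2])
    ((fun v : 'rV[R]_(d * k) =>
       enorm (col ij.1 (vec_mx v) - col ij.2 (vec_mx v))) @^-1`
     [set r | m ij.1 ij.2 <= r]))%classic); last first.
  apply/seteqP; split=> [v vm [i j] ij|v vm i j ij]; first exact: vm.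
  exact: (vm (i, j)).
apply: closed_bigI => -[i j] _; apply: preimage_closed; last exact: closed_ge.
move=> v _; apply: (@cvg_enorm _ _ (nbhs v) (nbhs_filter v)) => a; rewrite !mxE.
have -> : (fun u : 'rV[R]_(d * k) =>
      (col i (vec_mx u) - col j (vec_mx u)) a ord0) =
    (fun u => u ord0 (mxvec_index a i) - u ord0 (mxvec_index a j)).
  by apply/funext => u; rewrite !mxE.
by apply: (@cvgB _ _ _ (nbhs v) (nbhs_filter v)); exact: coord.
Qed.

Lemma config_space_neq0 (R : realType) (d k : nat) :
  (0 < d)%N -> exists x : 'M[R]_(d, k), config_space x.
Proof.
move=> d0; exists (\matrix_(a, i) i%:R) => i j ij /colP/(_ (Ordinal d0)).
by move/eqP; rewrite !mxE eqr_nat ltn_eqF.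
Qed.

Section Connected.
Context (R : realType) (d k l : nat) (e : 'I_l -> {set 'I_k}).
Context (w : 'I_k -> R) (c : 'I_l -> R) (alpha beta gamma delta : R).
Hypotheses (w_gt0 : forall i, 0 < w i) (c_gt0 : forall j, 0 < c j).
Hypotheses (alpha_gt0 : 0 < alpha) (beta_gt0 : 0 < beta).
Hypotheses (gamma_gt0 : 0 < gamma) (delta_gt0 : 0 < delta).

Local Notation f := (@energy R d k l e w c alpha beta gamma delta).

(** [B j] solves [alpha / 2 * c j * r ^ gamma = C] for nonnegative [C], hence bounds the distance
    from a vertex of [e j] to its centroid. Passing through the centroid costs two such bounds per
    path step; summing over [j] gives one constant for all hyperedges. *)
Lemma sublevel_dist_le (C : R) : ~ disconnected e ->
  exists M : R, forall x : 'M[R]_(d, k), f x <= C ->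
    forall a i i', `|x a i - x a i'| <= M.
Proof.
move=> conn_e; pose B j := (C / (alpha / 2 * c j)) `^ gamma^-1.
have B0 j : 0 <= B j by exact: powR_ge0.
exists ((2 * \sum_j B j) *+ k) => x xC a i i'.
apply: (connect_dist_le (adj := share_edge e) (g := x a)); last first.
- exact: connect_share_edge.
- have edge_le j i1 : i1 \in e j ->
      `|x a i1 - centroid (e j) x a ord0| <= \sum_j B j.
    move=> i1j; have := ler_norm_enorm (col i1 x - centroid (e j) x) a.
    rewrite !mxE => /le_trans; apply.
    apply: (@le_trans _ _ (B j)); last first.
      by rewrite (bigD1 j)//= lerDl sumr_ge0.
    apply: ler_powR_inv => //; first exact: enorm_ge0.
    rewrite ler_pdivlMr ?mulr_gt0 ?divr_gt0// mulrC.
    apply: le_trans xC; exact: energy_ge_spring.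
  move=> i1 i2 /existsP[j /andP[/edge_le i1j /edge_le i2j]].
  rewrite -(subrK (centroid (e j) x a ord0) (x a i1)) -addrA.
  rewrite -[X in _ + X]opprB mulr2n mulrDl !mul1r.
  by rewrite (le_trans (ler_normB _ _))// lerD.
- by rewrite mulr_ge0// sumr_ge0.
Qed.

(** The gap [m i j] is the distance at which the repulsion term of the pair, counted once, equals
    [C]. *)
Lemma sublevel_sep (C : R) : 0 < C ->
  exists2 m : 'I_k -> 'I_k -> R, forall i j, 0 < m i j &
    forall x : 'M[R]_(d, k), config_space x -> f x <= C ->
    forall i j, i != j -> m i j <= enorm (col i x - col j x).
Proof.
move=> C0; exists (fun i j => (beta / 2 * (w i * w j) / C) `^ delta^-1).
  by move=> i j; rewrite powR_gt0// !(divr_gt0, mulr_gt0).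
move=> x Ux xC i j ij; apply: powR_inv_ler => //; first exact: enorm_ge0.
  by rewrite ltW// !(divr_gt0, mulr_gt0).
have r0 : 0 < enorm (col i x - col j x) `^ delta.
  by rewrite powR_gt0// enorm_dist_gt0.
rewrite ler_pdivrMr// [leRHS]mulrC -ler_pdivrMr// -[leLHS]mulrA.
by apply: le_trans xC; exact: energy_ge_repulsion.
Qed.

Lemma connected_min : (0 < k)%N -> (0 < d)%N -> ~ disconnected e ->
  attains_min (@config_space R d k) f.
Proof.
move=> k0 d0 conn_e; have [x0 Ux0] := @config_space_neq0 R d k d0.
(* Adding 1 makes the level positive, as [sublevel_sep] requires, even if [f x0] is 0, as happens
   for a single vertex. *)
pose C := f x0 + 1.
have C0 : 0 < C by rewrite ltr_wpDl// energy_ge0.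
have [M M_ge] := sublevel_dist_le C conn_e.
have [m m_gt0 m_le] := sublevel_sep C0.
pose K := [set v : 'rV[R]_(d * k) | (forall i, - M <= v ord0 i <= M) /\
    (forall i j, i != j ->
       m i j <= enorm (col i (vec_mx v) - col j (vec_mx v)))]%classic.
(* The positive gaps keep the closed set [K] inside the region where the energy is continuous. *)
have KU v : K v -> config_space (vec_mx v).
  move=> [_ vm]; apply: config_space_of_dist_gt0 => i j ij.
  exact: lt_le_trans (m_gt0 i j) (vm _ _ ij).
have sublevelK (y : 'M[R]_(d, k)) : config_space y -> f y <= C ->
    exists2 v, K v & f (vec_mx v) = f y.
  (* Translating vertex 0 to the origin turns coordinates into coordinate differences, which [M]
     bounds. *)
  move=> Uy yC; pose u := col (Ordinal k0) y.
  pose z := \matrix_(a, i) (y a i - u a ord0) : 'M[R]_(d, k).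
  have zE i : col i z = col i y - u by apply/colP => a; rewrite !mxE.
  exists (mxvec z); last by rewrite mxvecK; apply: energy_translate zE.
  split=> [i|i j ij].
    case/mxvec_indexP: i => a i; rewrite mxvecE !mxE -ler_norml.
    exact: M_ge.
  by rewrite mxvecK !zE opprB addrA subrK; exact: m_le.
have [v0 Kv0 fv0] : exists2 v, K v & f (vec_mx v) = f x0.
  by apply: sublevelK => //; rewrite lerDl.
have f_cont : {within K, continuous (fun v => f (vec_mx v))}%classic.
  apply: continuous_in_subspaceT => v /set_mem Kv.
  have vec_mx_coord a i : ((fun u : 'rV[R]_(d * k) => vec_mx u a i) @ v -->
      vec_mx v a i)%classic.
    by under eq_fun do rewrite mxE; rewrite mxE; exact: coord_continuous.
  exact: (@cvg_energy R _ (nbhs v) (nbhs_filter v) d k l e w c _ _ _ _ vec_mx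
    (vec_mx v) gamma_gt0 delta_gt0 (KU v Kv) vec_mx_coord).
have K_compact : compact K by exact: compact_config.
have [v /set_mem Kv v_min] :=
  EVT_min_rV (ex_intro K v0 Kv0 : (K !=set0)%classic) K_compact f_cont.
exists (vec_mx v) => [|y Uy]; first exact: KU.
(* Below level [C], [y] has a representative in [K] of the same energy; above it, [y] is compared
   with [x0], represented by [v0]. *)
have /orP[yC|Cy] := le_total (f y) C.
  have [v' Kv' fv'] := sublevelK _ Uy yC.
  by apply: (le_trans (v_min v' (mem_set Kv'))); rewrite fv'.
apply: le_trans Cy; apply: (@le_trans _ _ (f x0)); last by rewrite lerDl.
by apply: (le_trans (v_min v0 (mem_set Kv0))); rewrite fv0.
Qed.

End Connected.

Theorem theorem2p2 (R : realType) (k l d : nat)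
    (e : 'I_l -> {set 'I_k}) (w : 'I_k -> R) (c : 'I_l -> R)
    (alpha beta gamma delta : R)
    (k_gt0 : (0 < k)%N)
    (e_neq0 : forall j : 'I_l, e j != finset.set0)
    (w_gt0 : forall i : 'I_k, 0 < w i)
    (c_gt0 : forall j : 'I_l, 0 < c j)
    (d_ge3 : (3 <= d)%N)
    (alpha_gt0 : 0 < alpha) (beta_gt0 : 0 < beta)
    (gamma_gt0 : 0 < gamma) (delta_gt0 : 0 < delta) :
  exactly_one
    (attains_min (@config_space R d k)
       (energy e w c alpha beta gamma delta))
    (disconnected e).
Proof.
have d_gt0 : (0 < d)%N by exact: leq_trans d_ge3.
case: (pselect (disconnected e)) => [disc_e|conn_e].
  by right; split=> //; exact: disconnected_not_min.
by left; split=> //; exact: connected_min.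
Qed.
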